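(* Let $\mathcal{O}=\mathbb{Z}\omega_1\oplus\cdots\oplus\mathbb{Z}\omega_n$ be a Dedekind domain with finite rank, with multiplication table $(c_{ijk})_{1\le i,j,k\le n}$ of integers, $\omega_i\omega_j=\sum_{k=1}^n c_{ijk}\omega_k$. Let $I=(\alpha,\beta)$ be a nonzero ideal of $\mathcal{O}$ with $0\neq\alpha=\sum_{i=1}^n a_i\omega_i$ and $\beta=\sum_{i=1}^n b_i\omega_i$ ($a_i,b_i\in\mathbb{Z}$), and let $h_I$ be a multiple-norm of $I$. Then the Main Algorithm described in the context, run on this input, is correct: it outputs either ''$I=\mathcal{O}$'', in which case indeed $I=\mathcal{O}$, or a sequence of integers $(m;d_1,\ldots,d_m;(l_{ijk})_{1\le i,j,k\le m})$ which is a basis representation of the factor ring $R=\mathcal{O}/I$.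
   Context: All rings are commutative with $1\neq 0$. A Dedekind domain is a noetherian integral domain whose localization at every nonzero prime ideal is a discrete valuation ring; it has finite rank if it is finitely generated as a $\mathbb{Z}$-module, and it is then represented by a $\mathbb{Z}$-basis $\omega_1,\ldots,\omega_n$ and the multiplication table $(c_{ijk})$. The norm of a nonzero ideal $J$ is $\mathcal{N}(J)=|\mathcal{O}/J|$, and $\mathcal{N}(\alpha)=\mathcal{N}((\alpha))$. A multiple-norm of $I=(\alpha,\beta)$ is a positive integer $h_I$ that is a multiple of $\mathcal{N}(\alpha)$ if $\beta=0$, and a multiple of both $\mathcal{N}(\alpha)$ and $\mathcal{N}(\beta)$ if $\beta\neq0$. Basis representation: for a finite ring $R$, a sequence of integers $(m;d_1,\ldots,d_m;(l_{ijk})_{1\le i,j,k\le m})$ with $m>0$, $d_i\ge2$, $0\le l_{ijk}<d_k$, such that there are $\upsilon_1,\ldots,\upsilon_m\in R$ with $(R,+)=\mathbb{Z}_{d_1}\upsilon_1\oplus\cdots\oplus\mathbb{Z}_{d_m}\upsilon_m$, $d_i$ being the additive order of $\upsilon_i$, and $\upsilon_i\upsilon_j=\sum_{k=1}^m l_{ijk}\upsilon_k$ for all $i,j$. Normal forms: the Hermite normal form of an $n\times m$ integer matrix $N$ of rank $n$ is the unique matrix $NU=(0\;H)$ with $U$ unimodular and $H=(h_{ij})$ an $n\times n$ upper triangular matrix with $h_{ii}\ge1$ and $0\le h_{ij}<h_{ii}$ for $j>i$. The Smith normal form of a nonsingular $n\times n$ integer matrix $N$ is the diagonal matrix $S=VNU=\mathrm{diag}(d_1,\ldots,d_n)$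 with $U,V$ unimodular, $d_i\geq 1$ and $d_{i+1}\mid d_i$ for $1\le i<n$. Main Algorithm (input $\mathcal{O}$, $I=(\alpha,\beta)$, $h_I$): (1) Compute $A=(a_{ij})$, $B=(b_{ij})$ with $a_{ij}=\sum_{k}a_kc_{kij}$, $b_{ij}=\sum_k b_kc_{kij}$ for $1\le i,j\le n$. (2) Let $H_A$, $H_B$ be the Hermite normal forms of $A^T$, $B^T$ ($H_B$ is only needed if $\beta\ne 0$). (3) If $\beta=0$ put $H_M=H_A$; otherwise let $(0\;H_M)$ be the Hermite normal form of the $n\times 2n$ matrix $M=(H_A,H_B)$. (4) Compute the Smith normal form $S=VH_MU=\mathrm{diag}(d_1,\ldots,d_n)$, $d_{i+1}\mid d_i$, with unimodular $U,V$. (5) If $\det(S)=\prod_{i=1}^n d_i=1$, output ''$I=\mathcal{O}$'' and stop. (6) Let $\tilde V$ be the inverse matrix of $V$ over $\mathbb{Z}_{h_I}=\mathbb{Z}/h_I\mathbb{Z}$ (viewed as an integer matrix), and for $1\le k\le n$ compute $\tilde A_k=(\tilde a_{ijk})_{1\le i,j\le n}=\tilde V^{T}(c_{ijk})_{1\le i,j\le n}\tilde V$. (7) For all $1\le i,j\le n$ compute $(\tilde t_{ij1},\ldots,\tilde t_{ijn})^T=V(\tilde a_{ij1},\ldots,\tilde a_{ijn})^T$. (8) Put $l_{ijk}=\tilde t_{ijk}\bmod d_k$ (smallest nonnegative residue), and output $(m;d_1,\ldots,d_m;(l_{ijk})_{1\le i,j,k\le m})$, where $d_1,\ldots,d_m$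 are exactly those $d_i$ that are greater than $1$. *)

(* Defs.v *)
From HB Require Import structures.
From mathcomp Require Import all_boot all_order all_algebra.
From mathcomp Require Import finmap.
From mathcomp Require Import boolp classical_sets cardinality.

Set Implicit Arguments.
Unset Strict Implicit.
Unset Printing Implicit Defensive.

Import Order.TTheory GRing.Theory Num.Theory.
Local Open Scope ring_scope.
Local Open Scope quotient_scope.

(* MathComp's [idealr] only covers proper ideals; here the unit ideal is
   allowed, so the quotient by an ideal may be the zero ring. *)

Definition absorbing (R : nzRingType) (S : {pred R}) : Prop :=
  forall a, {in S, forall u, a * u \in S}.

HB.mixin Record isAbsorbing (R : nzRingType) (S : R -> bool) := {
  absorbing_subproof : absorbing S
}.

#[short(type="ideal")]
HB.structure Definition Ideal (R : nzRingType) :=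
  {S of GRing.ZmodClosed R S & isAbsorbing R S}.

Lemma idealMl (R : nzRingType) (I : ideal R) (a u : R) :
  u \in I -> a * u \in I.
Proof. exact: absorbing_subproof. Qed.

Section GeneratedIdeal.
Variables (R : comNzRingType) (s : seq R).

Definition ideal_gen_pred : R -> bool :=
  fun x => `[< exists c : 'I_(size s) -> R, x = \sum_i c i * s`_i >].

Lemma ideal_genP (x : R) :
  reflect (exists c : 'I_(size s) -> R, x = \sum_i c i * s`_i)
          (x \in ideal_gen_pred).
Proof. exact: asboolP. Qed.

Lemma ideal_gen_zmod_closed : zmod_closed ideal_gen_pred.
Proof.
split=> [|x y /ideal_genP[c ->] /ideal_genP[e ->]]; apply/ideal_genP.
  by exists (fun=> 0); rewrite big1 // => i _; rewrite mul0r.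
exists (fun i => c i - e i); rewrite -sumrB.
by apply: eq_bigr => i _; rewrite mulrBl.
Qed.

HB.instance Definition _ :=
  GRing.isZmodClosed.Build R ideal_gen_pred ideal_gen_zmod_closed.

Lemma ideal_gen_absorbing : absorbing ideal_gen_pred.
Proof.
move=> a x /ideal_genP[c ->]; apply/ideal_genP; exists (fun i => a * c i).
by rewrite mulr_sumr; apply: eq_bigr => i _; rewrite mulrA.
Qed.

HB.instance Definition _ := isAbsorbing.Build R ideal_gen_pred ideal_gen_absorbing.

Definition ideal_gen : ideal R := Ideal.clone R ideal_gen_pred _.

End GeneratedIdeal.

Section FactorRing.
Variables (R : comNzRingType) (I : ideal R).

Definition factor_ring : Type := Quotient.quot I.

HB.instance Definition _ := Choice.on factor_ring.
HB.instance Definition _ := GRing.Zmodule.on factor_ring.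
HB.instance Definition _ :=
  EqQuotient.copy factor_ring (Quotient.quot I).

Let one : factor_ring := \pi_(Quotient.quot I) 1.
Let mul (x y : factor_ring) : factor_ring :=
  \pi_(Quotient.quot I) (repr x * repr y).

Let pi_mul (x y : R) :
  \pi_(Quotient.quot I) (x * y) =
  mul (\pi_(Quotient.quot I) x) (\pi_(Quotient.quot I) y).
Proof.
apply/eqP; rewrite -Quotient.idealrBE.
set x' := repr _; set y' := repr _.
have hx : x - x' \in I by rewrite Quotient.idealrBE reprK.
have hy : y - y' \in I by rewrite Quotient.idealrBE reprK.
have -> : x * y - x' * y' = y * (x - x') + x' * (y - y').
  by rewrite !mulrBr addrA [y * x]mulrC [y * x']mulrC subrK.
by rewrite rpredD ?idealMl.
Qed.

Let piP (x : factor_ring) : exists r, x = \pi_(Quotient.quot I) r.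
Proof. by exists (repr x); rewrite reprK. Qed.

Let mulA : associative mul.
Proof.
move=> x y z; have [a ->] := piP x; have [b ->] := piP y.
by have [c ->] := piP z; rewrite -!pi_mul mulrA.
Qed.

Let mulC : commutative mul.
Proof. by move=> x y; rewrite /mul mulrC. Qed.

Let mul1 : left_id one mul.
Proof. by move=> x; have [a ->] := piP x; rewrite -pi_mul mul1r. Qed.

Let mulDl : left_distributive mul +%R.
Proof.
move=> x y z; have [a ->] := piP x; have [b ->] := piP y.
have [c ->] := piP z.
by rewrite -raddfD -!pi_mul mulrDl raddfD.
Qed.

HB.instance Definition _ :=
  GRing.Zmodule_isComPzRing.Build factor_ring mulA mulC mul1 mulDl.

Definition factor_proj (x : R) : factor_ring := \pi_(Quotient.quot I) x.

Fact factor_proj_is_zmod_morphism : zmod_morphism factor_proj.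
Proof. by move=> x y; rewrite /factor_proj raddfB. Qed.

Fact factor_proj_is_monoid_morphism : monoid_morphism factor_proj.
Proof. by split=> // x y; rewrite /factor_proj pi_mul. Qed.

HB.instance Definition _ :=
  GRing.isZmodMorphism.Build R factor_ring factor_proj
    factor_proj_is_zmod_morphism.
HB.instance Definition _ :=
  GRing.isMonoidMorphism.Build R factor_ring factor_proj
    factor_proj_is_monoid_morphism.

Lemma factor_proj_surj (x : factor_ring) : exists r, factor_proj r = x.
Proof. by have [r ->] := piP x; exists r. Qed.

Lemma factor_proj_eq0 (x : R) : (factor_proj x == 0) = (x \in I).
Proof. by rewrite -(raddf0 (\pi_(Quotient.quot I))) -Quotient.idealrBE subr0. Qed.

End FactorRing.

(* The junk value for an infinite quotient is 0. *)
Definition ideal_norm (R : comNzRingType) (I : ideal R) : nat :=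
  #|` fset_set [set: factor_ring I] |.

Definition elt_norm (R : comNzRingType) (x : R) : nat :=
  ideal_norm (ideal_gen [:: x]).

Definition noetherian (R : comNzRingType) : Prop :=
  forall I : ideal R, exists s : seq R, I =i ideal_gen s.

Definition principal_ideal_domain (R : comNzRingType) : Prop :=
  (forall x y : R, x * y = 0 -> x = 0 \/ y = 0) /\
  (forall I : ideal R, exists x : R, I =i ideal_gen [:: x]).

Definition nonzero_ideal (R : nzRingType) (I : {pred R}) : Prop :=
  exists2 x, x \in I & x != 0.

Definition discrete_valuation_ring (R : comNzRingType) : Prop :=
  principal_ideal_domain R /\
  exists P : prime_idealr R, nonzero_ideal P /\
    forall Q : prime_idealr R, nonzero_ideal Q -> Q =i P.

Section Localization.
Variables (R : idomainType) (P : prime_idealr R).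
Local Notation "x %:F" := (FracField.tofrac x).

Definition local_fraction : {fraction R} -> bool :=
  fun x => `[< exists a s : R, s \notin P /\ x = a%:F / s%:F >].

Lemma local_fraction_subring_closed : subring_closed local_fraction.
Proof.
have P0 s : s \notin P -> s%:F != 0.
  by apply: contraNneq => /eqP; rewrite tofrac_eq0 => /eqP->; rewrite rpred0.
have PM s t : s \notin P -> t \notin P -> s * t \notin P.
  by move=> hs ht; rewrite prime_idealrM negb_or hs.
split.
- apply/asboolP; exists 1, 1; rewrite idealr1; split=> //.
  by rewrite tofrac1 divr1.
- move=> x y /asboolP[a [s [hs ->]]] /asboolP[b [t [ht ->]]].
  apply/asboolP; exists (a * t - b * s), (s * t); split; first exact: PM.
  by rewrite tofracB !tofracM -mulNr addf_div ?P0 // mulNr.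
- move=> x y /asboolP[a [s [hs ->]]] /asboolP[b [t [ht ->]]].
  apply/asboolP; exists (a * b), (s * t); split; first exact: PM.
  by rewrite !tofracM mulf_div.
Qed.

HB.instance Definition _ :=
  GRing.isSubringClosed.Build {fraction R} local_fraction
    local_fraction_subring_closed.

Record localization := Localization {
  localization_val :> {fraction R};
  _ : localization_val \in local_fraction }.

HB.instance Definition _ := [isSub for localization_val].
HB.instance Definition _ := [Choice of localization by <:].
HB.instance Definition _ :=
  [SubChoice_isSubComNzRing of localization by <:].

End Localization.

Definition dedekind (O : idomainType) : Prop :=
  noetherian O /\
  forall P : prime_idealr O, nonzero_ideal P ->
    discrete_valuation_ring (localization P).

Definition Zcomb (V : zmodType) (n : nat) (w : 'I_n -> V) (a : 'rV[int]_n) : V :=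
  \sum_i w i *~ a 0 i.

Definition Zbasis (V : zmodType) (n : nat) (w : 'I_n -> V) : Prop :=
  forall x : V, exists! a : 'rV[int]_n, x = Zcomb w a.

Definition multiplication_table (R : comNzRingType) (n : nat)
    (w : 'I_n -> R) (c : 'I_n -> 'I_n -> 'I_n -> int) : Prop :=
  forall i j, w i * w j = \sum_k w k *~ c i j k.

Definition multiple_norm (R : comNzRingType) (x y : R) (h : nat) : Prop :=
  [/\ (0 < h)%N, (elt_norm x %| h)%N & y != 0 -> (elt_norm y %| h)%N].

Definition additive_order (V : zmodType) (x : V) (d : int) : Prop :=
  [/\ 0 < d, x *~ d = 0 & forall e : int, 0 < e < d -> x *~ e != 0].

(* The additive group is the direct sum of the cyclic groups generated by the
   [v i]: each element is a unique combination with i-th coefficient in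
   {0, ..., d_i - 1}. *)
Definition cyclic_decomposition (V : zmodType) (m : nat)
    (v : 'I_m -> V) (d : 'I_m -> int) : Prop :=
  (forall i, additive_order (v i) (d i)) /\
  forall x : V, exists! z : 'rV[int]_m,
    (forall i, 0 <= z 0 i < d i) /\ x = Zcomb v z.

Definition basis_representation (R : comPzRingType) (m : nat)
    (d : 'I_m -> int) (l : 'I_m -> 'I_m -> 'I_m -> int) : Prop :=
  [/\ finite_set [set: R], (0 < m)%N, forall i, 2 <= d i,
      forall i j k, 0 <= l i j k < d k &
      exists v : 'I_m -> R, cyclic_decomposition v d /\
        forall i j, v i * v j = \sum_k v k *~ l i j k].

(* The n x (k + n) matrix N automatically has rank n, since \det H > 0. *)
Definition hermite_normal_form (n k : nat)
    (N : 'M[int]_(n, k + n)) (H : 'M[int]_n) : Prop :=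
  [/\ exists2 U : 'M[int]_(k + n), U \in unitmx & N *m U = row_mx 0 H,
      forall i j : 'I_n, (j < i)%N -> H i j = 0,
      forall i, 1 <= H i i &
      forall i j : 'I_n, (i < j)%N -> 0 <= H i j < H i i].

Definition smith_normal_form (n : nat) (N V U S : 'M[int]_n) : Prop :=
  [/\ V \in unitmx, U \in unitmx, S = V *m N *m U, is_diag_mx S &
      (forall i, 1 <= S i i) /\
      (forall i j : 'I_n, j = i.+1 :> nat -> (S j j %| S i i)%Z)].

(* W is any integer lift of the inverse of V over Z/hZ. *)
Definition inverse_mod (n : nat) (h : nat) (V W : 'M[int]_n) : Prop :=
  forall i j,
    ((V *m W) i j = (1%:M : 'M[int]_n) i j %[mod h])%Z /\
    ((W *m V) i j = (1%:M : 'M[int]_n) i j %[mod h])%Z.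

Inductive algorithm_output : Type :=
| WholeRing
| BasisRepresentation (m : nat) (d : 'I_m -> int)
    (l : 'I_m -> 'I_m -> 'I_m -> int).

Section MainAlgorithm.
Variables (n : nat) (c : 'I_n -> 'I_n -> 'I_n -> int).
Variables (a b : 'rV[int]_n) (h : nat).

(* Row i is the coordinate vector of (\sum_k x_k w_k) * w_i. *)
Definition mul_matrix (x : 'rV[int]_n) : 'M[int]_n :=
  \matrix_(i, j) \sum_k x 0 k * c k i j.

Definition hermite_phase (HM : 'M[int]_n) : Prop :=
  exists2 HA : 'M[int]_n,
    @hermite_normal_form n 0 (mul_matrix a)^T HA &
    if b == 0 then HM = HA
    else exists2 HB : 'M[int]_n,
      @hermite_normal_form n 0 (mul_matrix b)^T HB &
      hermite_normal_form (row_mx HA HB) HM.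

Definition tilde_a (W : 'M[int]_n) (k : 'I_n) : 'M[int]_n :=
  W^T *m (\matrix_(i, j) c i j k) *m W.

Definition tilde_t (V W : 'M[int]_n) (i j k : 'I_n) : int :=
  (V *m \col_r tilde_a W r i j) k 0.

(* The runs of the algorithm on the input (c, a, b, h): the transforming
   matrices U, V and the lift of the inverse of V are not determined by the
   input.  Here b == 0 tests beta = 0. *)
Inductive main_algorithm : algorithm_output -> Prop :=
| run_whole (HM V U S : 'M[int]_n) :
    hermite_phase HM -> smith_normal_form HM V U S -> \det S = 1 ->
    main_algorithm WholeRing
| run_basis (HM V U S W : 'M[int]_n) (m : nat) (le_mn : (m <= n)%N) :
    hermite_phase HM -> smith_normal_form HM V U S -> \det S != 1 ->
    inverse_mod h V W ->
    (forall i : 'I_n, (i < m)%N = (1 < S i i)) ->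
    let w := widen_ord le_mn in
    main_algorithm
      (BasisRepresentation (fun k : 'I_m => S (w k) (w k))
         (fun i j k : 'I_m =>
            (tilde_t V W (w i) (w j) (w k) %% S (w k) (w k))%Z)).

End MainAlgorithm.

Definition correct_output (O : comNzRingType) (I : ideal O)
    (out : algorithm_output) : Prop :=
  match out with
  | WholeRing => forall x : O, x \in I
  | BasisRepresentation _ d l => basis_representation (factor_ring I) d l
  end.

(* Main.v *)
Require Import Defs.
From HB Require Import structures.
From mathcomp Require Import all_boot all_order all_algebra.
From mathcomp Require Import finmap boolp classical_sets cardinality.
From mathcomp Require Import perm ring zify.

Set Implicit Arguments.
Unset Strict Implicit.
Unset Printing Implicit Defensive.

Import Order.TTheory GRing.Theory Num.Theory.
Local Open Scope ring_scope.

(** Multiplication by alpha is, on coordinates, the matrix A, so the columns of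
    A^T (together with those of B^T) generate the lattice of coordinate vectors
    of I.  Unimodular column operations do not change a column lattice: by
    [hermite_phase_ideal], u is the coordinate vector of an element of I iff
    u^T is an integral combination of the columns of H_M.  With S = V H_M U,
    this happens iff d_k divides the k-th entry of V u^T for each k
    ([smith_colspan]).  Hence u |-> V u^T identifies O/I with the direct sum of
    the groups Z/d_k, the generators being the classes v_k of the elements
    whose coordinates are the columns of V^-1.  If det S = 1 all d_k are 1 and
    I = O; otherwise the summands with d_k = 1 come last and vanish
    ([cyclic_decomposition_truncate]).

    It remains to see that the table of products is right although the
    algorithm only knows V^-1 modulo h.  By Lagrange's theorem in the group
    O/(alpha), the norm of alpha annihilates O/(alpha), and so h annihilates
    O/I ([norm_kills]).  Therefore v_k is also the class of the element whose
    coordinates are the k-th column of the lift W, and expanding v_i v_j with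
    the structure constants of O gives the coefficients computed by the
    algorithm, which matter only modulo d_k.

    The algorithm has at least one run because the normal forms exist.
    Multiplication by alpha is injective, so the matrices involved have
    independent rows.  The Hermite form is then obtained by gcd elimination,
    one row after the other ([hermite_exists]), and the Smith form from the one
    with increasing divisibility by reversing the order of the basis vectors
    ([smith_exists]). *)

(** * Existence of the Hermite normal form *)

(** The Smith form of a single row has only one possibly nonzero entry, the gcd
    of the row; a global change of sign makes it nonnegative. *)
Lemma row_gcd_unimodular p (u : 'rV[int]_(1 + p)) :
  exists2 U : 'M[int]_(1 + p), U \in unitmx &
  exists2 g : int, 0 <= g & u *m U = row_mx g%:M 0.
Proof.
have [L _ [R uR [d _ Eu]]] := int_Smith_normal_form u.
have {Eu} EuR : u *m invmx R = row_mx (L 0 0 * d`_0)%:M 0.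
  rewrite Eu mulmxK //; apply/matrixP => i j; rewrite ord1 mxE big_ord1.
  rewrite -[j]splitK; case: (split j) => k /=; last first.
    by rewrite row_mxEr !mxE mulr0n mulr0.
  by rewrite row_mxEl (ord1 k) !mxE /= !mulr1n.
have [g_ge0 | g_lt0] := leP 0 (L 0 0 * d`_0).
  by exists (invmx R); rewrite ?unitmx_inv //; exists (L 0 0 * d`_0).
exists (- invmx R).
  by rewrite -scaleN1r unitmxZ ?unitmx_inv // unitrN1.
exists (- (L 0 0 * d`_0)); first by rewrite oppr_ge0 ltW.
by rewrite mulmxN EuR opp_row_mx oppr0 raddfN.
Qed.

(** The entries are reduced from top to bottom: subtracting a multiple of the
    i-th column of [T] changes no entry above the i-th one. *)
Lemma lower_reduce n p (T : 'M[int]_(n, p)) (v : 'cV[int]_n) (le_np : (n <= p)%N) :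
  (forall (i : 'I_n) (j : 'I_p), (i < j)%N -> T i j = 0) ->
  (forall i, 0 < T i (widen_ord le_np i)) ->
  exists q : 'cV[int]_p,
    forall i, 0 <= (v + T *m q) i 0 < T i (widen_ord le_np i).
Proof.
elim: n p T v le_np => [|n IHn] p T v le_np; first by exists 0 => -[].
case: p T le_np => [//|p] T le_np T0 Tpos.
pose T1 : 'M_(1 + n, 1 + p) := T; pose T' := drsubmx T1.
have le_np' : (n <= p)%N := le_np.
have T0' (i : 'I_n) (j : 'I_p) : (i < j)%N -> T' i j = 0.
  by move=> ij; rewrite !mxE T0.
have widenE i : widen_ord le_np (rshift 1 i) = rshift 1 (widen_ord le_np' i).
  exact: val_inj.
have Tpos' i : 0 < T' i (widen_ord le_np' i).
  by rewrite !mxE -widenE Tpos.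
have wid0 : widen_ord le_np 0 = 0 by apply: val_inj.
have := Tpos 0; rewrite wid0 => T00.
pose s : int := - divz (v 0 0) (T 0 0).
have [q' q'P] :=
  IHn p T' (dsubmx (v : 'cV_(1 + n)) + dlsubmx T1 *m s%:M) le_np' T0' Tpos'.
exists (col_mx (s%:M : 'cV_1) q') => i.
have -> : v + T *m col_mx (s%:M : 'cV_1) q' =
   col_mx ((v 0 0)%:M + (T 0 0 * s)%:M)
     (dsubmx (v : 'cV_(1 + n)) + dlsubmx T1 *m s%:M + T' *m q').
  have ET : T = block_mx (T 0 0)%:M 0 (dlsubmx T1) T' :> 'M_(1 + n, 1 + p).
    apply: etrans (esym (@submxK _ 1 n 1 p T)) _; congr (block_mx _ _ _ _).
      by apply/matrixP => k l; rewrite !ord1 !mxE !lshift0.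
    by apply/matrixP => k l; rewrite !mxE T0 // ord1.
  have Ev : v = col_mx (v 0 0)%:M (dsubmx (v : 'cV_(1 + n))).
    apply: etrans (esym (@vsubmxK _ 1 n 1 v)) _; congr (col_mx _ _).
    by apply/matrixP => k l; rewrite !ord1 !mxE !lshift0.
  have ETq : T *m col_mx (s%:M : 'cV_1) q' =
      col_mx (T 0 0 * s)%:M (dlsubmx T1 *m s%:M + T' *m q').
    rewrite {1}ET; apply: etrans (@mul_block_col _ 1 n 1 p 1 _ _ _ _ _ _) _.
    by rewrite mul0mx addr0 -scalar_mxM.
  by rewrite {1}Ev ETq; apply: etrans (@add_col_mx _ 1 n 1 _ _ _ _) _; rewrite addrA.
have [[k ->]|[k ->]] :
  (exists k : 'I_1, i = lshift n k) \/ (exists k : 'I_n, i = rshift 1 k).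
- by rewrite -[i](@splitK 1 n); case: split => k; [left|right]; exists k.
- rewrite (@col_mxEu _ 1 n 1) ord1 lshift0 wid0 !mxE /= !mulr1n /s.
  have -> : v 0 0 + T 0 0 * - divz (v 0 0) (T 0 0) = modz (v 0 0) (T 0 0).
    by rewrite {1}(divz_eq (v 0 0) (T 0 0)); ring.
  by rewrite modz_ge0 ?gt_eqF //= ltz_pmod.
- by rewrite (@col_mxEd _ 1 n 1) widenE; have := q'P k; rewrite !mxE.
Qed.

Definition rows_independent n p (N : 'M[int]_(n, p)) : Prop :=
  forall u : 'rV_n, u *m N = 0 -> u = 0.

Lemma rows_independent_mulr n p (N : 'M[int]_(n, p)) (U : 'M_p) :
  U \in unitmx -> rows_independent N -> rows_independent (N *m U).
Proof.
move=> uU regN u uNU0; apply: regN.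
by rewrite -(mulmxK uU (u *m N)) -(mulmxA u) uNU0 mul0mx.
Qed.

(** The Hermite form read with rows and columns in the opposite order.  In
    this orientation a recursion on rows splits off the first row and column,
    which fits the block decomposition of matrices of size [1 + n]. *)
Definition lower_reduced n p (le_np : (n <= p)%N) (T : 'M[int]_(n, p)) : Prop :=
  [/\ forall (i : 'I_n) (j : 'I_p), (i < j)%N -> T i j = 0,
      forall i, 0 < T i (widen_ord le_np i) &
      forall (i : 'I_n) (j : 'I_p), (j < i)%N ->
        0 <= T i j < T i (widen_ord le_np i)].

Lemma lower_reduced_block n p (le_np : (n <= p)%N) (le_np1 : (1 + n <= 1 + p)%N)
    (g : int) (c : 'cV_n) (T : 'M_(n, p)) :
  0 < g -> (forall i, 0 <= c i 0 < T i (widen_ord le_np i)) ->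
  lower_reduced le_np T ->
  lower_reduced le_np1 (block_mx g%:M 0 c T).
Proof.
move=> g_gt0 cP [T0 Tpos Tred].
have wid0 (k : 'I_1) : widen_ord le_np1 (lshift n k) = lshift p k.
  exact: val_inj.
have widS i : widen_ord le_np1 (rshift 1 i) = rshift 1 (widen_ord le_np i).
  exact: val_inj.
split=> [i j|i|i j]; rewrite -[i]splitK; case: (split i) => k /=.
- rewrite -[j]splitK; case: (split j) => l /=; first by rewrite !ord1.
  by rewrite block_mxEur mxE.
- rewrite -[j]splitK; case: (split j) => l /=; first by rewrite (ord1 l).
  by rewrite block_mxEdr ltnS; apply: T0.
- by rewrite wid0 block_mxEul !ord1 mxE.
- by rewrite widS block_mxEdr.
- by rewrite (ord1 k).
- rewrite widS block_mxEdr -[j]splitK; case: (split j) => l /=.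
    by rewrite block_mxEdl (ord1 l).
  by rewrite block_mxEdr; apply: Tred.
Qed.

(** Induction on the rows: gcd elimination brings the first row to the form
    (g, 0, ..., 0), the induction hypothesis puts the remaining block in
    reduced form, and the columns of that block then reduce the entries below
    g.  Independence of the rows forces g to be nonzero. *)
Lemma lower_reduced_exists n p (N : 'M[int]_(n, p)) : rows_independent N ->
  exists2 U : 'M[int]_p, U \in unitmx &
  exists le_np : (n <= p)%N, lower_reduced le_np (N *m U).
Proof.
elim: n p N => [|n IHn] p N regN.
  exists 1%:M; first exact: unitmx1.
  by exists (leq0n p); split=> -[].
case: p N regN => [|p] N regN.
  have /matrixP/(_ 0 0)/eqP := regN (const_mx 1) (thinmx0 _).
  by rewrite !mxE oner_eq0.
have [U1 uU1 [g g_ge0 EU1]] :=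
  row_gcd_unimodular (usubmx (N : 'M_(1 + n, 1 + p))).
pose N1 : 'M_(1 + n, 1 + p) := N *m U1.
pose c := dlsubmx N1; pose N' := drsubmx N1.
have EN1 : N1 = block_mx g%:M 0 c N'.
  have u_N1 : usubmx N1 = row_mx g%:M 0 by rewrite -EU1 -mul_usub_mx.
  by rewrite -[LHS]submxK /ulsubmx /ursubmx u_N1 row_mxKl row_mxKr.
have regN1 : rows_independent N1 by apply: rows_independent_mulr.
have g_neq0 : g != 0.
  apply/eqP => g0; have := regN1 (row_mx 1%:M 0).
  rewrite EN1 mul_row_block !mul1mx !mul0mx g0 raddf0 !addr0 row_mx0 => /(_ erefl).
  by move/matrixP/(_ 0 (lshift n 0))/eqP; rewrite row_mxEl !mxE.
have regN' : rows_independent N'.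
  (* A relation u between the rows of N' becomes, once multiplied by g, a
     relation between all rows: the first row cancels the pivot column. *)
  move=> u uN'0; have := regN1 (row_mx (- (u *m c)) (g *: u)).
  rewrite EN1 mul_row_block mul_mx_scalar -!scalemxAl uN'0 scaler0 mulmx0 addr0.
  rewrite scalerN addNr row_mx0 => /(_ erefl).
  rewrite -[RHS]row_mx0 => /eq_row_mx [_] /matrixP gu0.
  apply/matrixP => i j; have /eqP := gu0 i j.
  by rewrite !mxE mulf_eq0 (negPf g_neq0) => /eqP.
have [U' uU' [le_np [T0 Tpos Tred]]] := IHn _ _ regN'.
have [q qP] := lower_reduce c T0 Tpos.
have le_np1 : (n < p.+1)%N := le_np.
pose U2 : 'M_(1 + p) := block_mx 1%:M 0 0 U' *m block_mx 1%:M 0 q 1%:M.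
exists (U1 *m U2).
  rewrite unitmx_mul uU1 unitmx_mul !unitmxE.
  by rewrite !(@det_lblock _ 1 p) !det1 !mul1r unitr1 andbT -unitmxE.
exists le_np1; rewrite mulmxA -/N1 EN1 /U2 mulmxA !(@mulmx_block _ 1 n 1 p 1 p).
rewrite !(mulmx1, mulmx0, mul0mx, addr0, add0r).
by apply: lower_reduced_block => //; rewrite lt_def g_neq0.
Qed.

Lemma hermite_exists n k (N : 'M[int]_(n, k + n)) :
  rows_independent N -> exists H, hermite_normal_form N H.
Proof.
move=> regN.
have regN' : rows_independent (row_perm (perm rev_ord_inj) N).
  move=> u; rewrite row_permE mulmxA => /regN uP0.
  by rewrite -(mulmxK (unitmx_perm int (perm rev_ord_inj)) u) uP0 mul0mx.
have [U uU [le_nk [T0 Tpos Tred]]] := lower_reduced_exists regN'.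
set T := _ *m U in T0 Tpos Tred.
have ET i j : T i j = (N *m U) (rev_ord i) j.
  by rewrite /T row_permE -mulmxA -row_permE mxE permE.
pose H : 'M[int]_n := \matrix_(i, j) T (rev_ord i) (rev_ord (rshift k j)).
have Hdiag i : H i i = T (rev_ord i) (widen_ord le_nk (rev_ord i)).
  rewrite mxE; congr (T _ _); apply: val_inj => /=.
  by rewrite -addnS subnDl.
exists H; split.
- exists (col_perm (perm rev_ord_inj) U).
    by rewrite col_permE unitmx_mul uU unitmx_perm.
  apply/matrixP => i j; rewrite col_permE mulmxA -col_permE mxE permE.
  rewrite -[i in LHS]rev_ordK -ET.
  rewrite -[j]splitK; case: (split j) => l /=.
    rewrite T0 ?row_mxEl ?mxE //=; have := ltn_ord l; have := ltn_ord i; lia.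
  by rewrite row_mxEr [RHS]mxE.
- move=> i j lt_ji; rewrite mxE T0 //=.
  have := ltn_ord i; lia.
- by move=> i; rewrite Hdiag -gtz0_ge1.
- move=> i j lt_ij; rewrite Hdiag mxE; apply: Tred => /=.
  have := ltn_ord j; lia.
Qed.

(** * Existence of the Smith normal form *)

(** The general Smith form has each diagonal entry dividing the next one and
    leaves signs free.  Conjugating by the reversal permutation [P] turns the
    divisibility around, and the diagonal matrix [E] of signs makes the
    entries positive. *)
Lemma smith_exists n (N : 'M[int]_n) : \det N != 0 ->
  exists V U S, smith_normal_form N V U S.
Proof.
move=> detN; have [L uL [R uR [d sd EN]]] := int_Smith_normal_form N.
set D := matrix_of_fun _ _ in EN.
pose P : 'M[int]_n := perm_mx (perm rev_ord_inj).
pose E : 'M[int]_n := diag_mx (\row_i sgz d`_i).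
have dN0 (i : 'I_n) : d`_i != 0.
  apply: contraNneq detN => di0; rewrite EN !det_mulmx.
  have -> : D = diag_mx (\row_i d`_i).
    by apply/matrixP => j k; rewrite !mxE.
  by rewrite det_diag (bigD1 i) //= mxE di0 mul0r mulr0 mul0r.
have uP : P \in unitmx by apply: unitmx_perm.
have uE : E \in unitmx.
  rewrite unitmxE det_diag; apply: unitr_prod => i _; rewrite mxE.
  by have := dN0 i; case: sgzP.
have ES i j : (P *m (E *m D) *m P^T) i j = `|d`_(rev_ord i)| *+ (i == j).
  rewrite /P tr_perm_mx -row_permE -col_permE /E mul_diag_mx !mxE !permE.
  rewrite val_eqE (inj_eq rev_ord_inj); case: eqP => _; last by rewrite !mulr0n mulr0.
  rewrite !mulr1n; by case: sgzP => [->|_|_]; rewrite ?mul0r ?mul1r ?mulN1r.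
exists (P *m (E *m invmx L)), (invmx R *m P^T), (P *m (E *m D) *m P^T); split.
- by rewrite !unitmx_mul uP uE unitmx_inv.
- by rewrite unitmx_mul unitmx_inv uR unitmx_tr.
- by rewrite EN !mulmxA mulmxKV // !(mulmxK, mulmxKV) // mulmxKV.
- apply/is_diag_mxP => i j ij; rewrite ES.
  by rewrite -val_eqE (negPf ij).
split=> [i|i j ij]; rewrite !ES !eqxx !mulr1n.
  by rewrite -gtz0_ge1 normr_gt0 dN0.
have Eij : rev_ord i = (rev_ord j).+1 :> nat by move=> /=; have := ltn_ord j; lia.
have := dN0 (rev_ord i); rewrite Eij => d_neq0.
(* Reading d beyond its size gives 0, which is excluded. *)
have lt_d : ((rev_ord j).+1 < size d)%N.
  by rewrite ltnNge; apply: contraNN d_neq0 => le_d; rewrite nth_default.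
by have := sortedP 0 sd _ lt_d; rewrite !dvdzE -!abszE !absz_nat.
Qed.

(** * Integral combinations and column lattices *)

Lemma Zcomb_is_zmod_morphism (V : zmodType) n (w : 'I_n -> V) :
  zmod_morphism (Zcomb w).
Proof.
move=> u v; rewrite /Zcomb -sumrB; apply: eq_bigr => i _.
by rewrite !mxE mulrzBr.
Qed.

HB.instance Definition _ (V : zmodType) n (w : 'I_n -> V) :=
  GRing.isZmodMorphism.Build _ _ (Zcomb w) (Zcomb_is_zmod_morphism w).

Lemma ZcombZ (V : zmodType) n (w : 'I_n -> V) (e : int) u :
  Zcomb w (e *: u) = Zcomb w u *~ e.
Proof.
rewrite /Zcomb mulrz_suml; apply: eq_bigr => i _.
by rewrite mxE mulrC mulrzA.
Qed.

Lemma Zcomb_mulmx (V : zmodType) m n (w : 'I_n -> V) u (P : 'M[int]_(m, n)) :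
  Zcomb w (u *m P) = Zcomb (fun i => Zcomb w (row i P)) u.
Proof.
rewrite mulmx_sum_row raddf_sum; apply: eq_bigr => i _.
exact: ZcombZ.
Qed.

Lemma raddf_Zcomb (V W : zmodType) (f : {additive V -> W}) n (w : 'I_n -> V) u :
  f (Zcomb w u) = Zcomb (f \o w) u.
Proof. by rewrite raddf_sum; apply: eq_bigr => i _; rewrite raddfMz. Qed.

Lemma Zcomb_delta (V : zmodType) n (w : 'I_n -> V) i :
  Zcomb w (delta_mx 0 i) = w i.
Proof.
rewrite /Zcomb (bigD1 i) //= mxE !eqxx mulr1z big1 ?addr0 // => j ji.
by rewrite mxE (negPf ji) andbF mulr0z.
Qed.

Lemma Zbasis_inj (V : zmodType) n (w : 'I_n -> V) :
  Zbasis w -> injective (Zcomb w).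
Proof.
move=> hw u v Euv; have [a [_ a_uniq]] := hw (Zcomb w u).
by rewrite -(a_uniq u) // (a_uniq v).
Qed.

Lemma Zbasis_surj (V : zmodType) n (w : 'I_n -> V) : Zbasis w ->
  forall x, exists u, x = Zcomb w u.
Proof. by move=> hw x; have [u [-> _]] := hw x; exists u. Qed.

Lemma rows_independent_det n (A : 'M[int]_n) : \det A != 0 <-> rows_independent A.
Proof.
split=> [detA u uA0|regA].
  by apply/eqP; apply: contraNT detA => u_neq0; apply/det0P; exists u.
by apply/negP => /det0P [u /eqP u_neq0 /regA].
Qed.

Lemma hermite_det_neq0 n k (N : 'M[int]_(n, k + n)) H :
  hermite_normal_form N H -> \det H != 0.
Proof.
move=> [_ H0 Hpos _]; rewrite -det_tr det_trig; last first.
  by apply/is_trig_mxP => i j ij; rewrite mxE H0.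
by apply/prodf_neq0 => i _; rewrite mxE gt_eqF // gtz0_ge1.
Qed.

(** Unimodular column operations preserve the lattice spanned by the columns,
    and zero columns do not contribute to it. *)
Lemma hermite_colspan n k (N : 'M[int]_(n, k + n)) H : hermite_normal_form N H ->
  forall t : 'cV_n, (exists y, t = N *m y) <-> (exists y, t = H *m y).
Proof.
move=> [[U uU ENU] _ _ _] t; split=> [[y ->]|[y ->]].
  exists (dsubmx (invmx U *m y)).
  rewrite -[in LHS](mulmxK uU N) ENU -mulmxA -[invmx U *m y in LHS]vsubmxK.
  by rewrite mul_row_col mul0mx add0r.
exists (U *m col_mx 0 y).
by rewrite mulmxA ENU mul_row_col mul0mx add0r.
Qed.

(** As N = V^-1 S U^-1 with U unimodular, [V] maps the column lattice of [N]
    onto that of the diagonal matrix [S]. *)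
Lemma smith_colspan n (N V U S : 'M[int]_n) : smith_normal_form N V U S ->
  forall t : 'cV_n,
    (exists y, t = N *m y) <-> (forall k, (S k k %| (V *m t) k 0%R)%Z).
Proof.
move=> [uV uU ES /is_diag_mxP diagS _] t.
have SE (y : 'cV_n) k : (S *m y) k 0 = S k k * y k 0.
  rewrite mxE (bigD1 k) //= big1 ?addr0 // => j jk.
  by rewrite diagS ?mul0r // eq_sym.
split=> [[y ->] k|dvdS].
  have -> : V *m (N *m y) = S *m (invmx U *m y).
    by rewrite ES !mulmxA (mulmxK uU).
  by rewrite SE dvdz_mulr.
pose y : 'cV_n := \col_k ((V *m t) k 0%R %/ S k k)%Z.
exists (U *m y).
rewrite -[LHS](mulKmx uV) [RHS]mulmxA -[N *m U](mulKmx uV) -mulmxA; congr (_ *m _).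
rewrite mulmxA -ES; apply/matrixP => k j; rewrite ord1 SE [y _ _]mxE.
by rewrite mulrC divzK.
Qed.

(** * The coordinate lattice of an ideal with two generators *)

Section Lattice.
Variables (O : idomainType) (n : nat) (w : 'I_n -> O) (hw : Zbasis w).
Variables (c : 'I_n -> 'I_n -> 'I_n -> int) (hc : multiplication_table w c).

Lemma mul_matrixE (a v : 'rV_n) :
  Zcomb w a * Zcomb w v = Zcomb w (v *m mul_matrix c a).
Proof.
rewrite Zcomb_mulmx mulr_sumr; apply: eq_bigr => i _.
rewrite mulrzAr; congr (_ *~ _); rewrite mulr_suml.
under eq_bigr do rewrite mulrzAl hc mulrz_suml.
rewrite exchange_big; apply: eq_bigr => j _ /=.
rewrite !mxE mulrz_sumr; apply: eq_bigr => k _.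
by rewrite mulrC mulrzA.
Qed.

(** Multiplication by a nonzero element of a domain is injective. *)
Lemma det_mul_matrix_neq0 (a : 'rV_n) :
  Zcomb w a != 0 -> \det (mul_matrix c a) != 0.
Proof.
move=> a_neq0; apply/negP => /det0P [v v_neq0 vA0].
move: (mul_matrixE a v); rewrite vA0 raddf0 => /eqP.
rewrite mulf_eq0 (negPf a_neq0) /= -(raddf0 (Zcomb w)) (inj_eq (Zbasis_inj hw)).
by rewrite (negPf v_neq0).
Qed.

Lemma mem_ideal_gen2 (x y z : O) :
  x \in ideal_gen [:: y; z] <-> exists e f, x = e * y + f * z.
Proof.
split=> [/ideal_genP [e ->]|[e [f ->]]].
  by rewrite !big_ord_recl big_ord0 addr0 /=; exists (e 0), (e (lift 0 0)).
apply/ideal_genP; exists (fun i => if i == 0 then e else f).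
by rewrite !big_ord_recl big_ord0 addr0.
Qed.

Lemma mem_ideal_coord (a b u : 'rV_n) :
  Zcomb w u \in ideal_gen [:: Zcomb w a; Zcomb w b] <->
  exists y z, u = y *m mul_matrix c a + z *m mul_matrix c b.
Proof.
rewrite mem_ideal_gen2; split=> [[e [f]]|[y [z ->]]]; last first.
  exists (Zcomb w y), (Zcomb w z).
  by rewrite raddfD /= -!mul_matrixE (mulrC _ (Zcomb w y)) (mulrC _ (Zcomb w z)).
have [y ->] := Zbasis_surj hw e; have [z ->] := Zbasis_surj hw f.
rewrite (mulrC (Zcomb w y)) (mulrC (Zcomb w z)) !mul_matrixE -raddfD.
move=> /(Zbasis_inj hw) ->.
by exists y, z.
Qed.

(** Both branches compute the same lattice: for b = 0 the matrix of
    multiplication by beta is zero and contributes nothing. *)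
Lemma hermite_phase_ideal (a b : 'rV_n) HM : hermite_phase c a b HM ->
  forall u, Zcomb w u \in ideal_gen [:: Zcomb w a; Zcomb w b] <->
    exists y, u^T = HM *m y.
Proof.
have trE (u y : 'rV[int]_n) A : u = y *m A <-> u^T = A^T *m y^T.
  rewrite -trmx_mul; split=> [->|/(congr1 trmx)] //.
  by rewrite !trmxK.
move=> [HA hHA]; have spanA := @hermite_colspan n 0 _ _ hHA.
have [b0 -> u|b_neq0 [HB hHB hHM] u] := eqVneq b 0; rewrite mem_ideal_coord.
  rewrite -spanA; split=> [[y [z]]|[y Ey]].
    have -> : mul_matrix c b = 0.
      by apply/matrixP => i j; rewrite !mxE big1 // => k _; rewrite b0 mxE mul0r.
    by rewrite mulmx0 addr0 => /trE ->; exists y^T.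
  by exists y^T, 0; rewrite mul0mx addr0; apply/trE; rewrite trmxK.
have spanB := @hermite_colspan n 0 _ _ hHB.
rewrite -(hermite_colspan hHM); split=> [[y [z ->]]|[y]].
  have [y' Ey] := (spanA (y *m mul_matrix c a)^T).1 (ex_intro _ y^T (trmx_mul _ _)).
  have [z' Ez] := (spanB (z *m mul_matrix c b)^T).1 (ex_intro _ z^T (trmx_mul _ _)).
  by exists (col_mx y' z'); rewrite mul_row_col raddfD /= Ey Ez.
rewrite -[y]vsubmxK mul_row_col.
have [y' ->] := (spanA (HA *m usubmx y)).2 (ex_intro _ _ erefl).
have [z' ->] := (spanB (HB *m dsubmx y)).2 (ex_intro _ _ erefl).
move=> /(congr1 trmx); rewrite trmxK raddfD /= !trmx_mul !trmxK => ->.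
by exists y'^T, z'^T.
Qed.

Lemma hermite_phase_exists (a b : 'rV_n) : Zcomb w a != 0 ->
  exists2 HM, hermite_phase c a b HM & \det HM != 0.
Proof.
move=> a_neq0.
have reg x : Zcomb w x != 0 -> rows_independent (mul_matrix c x)^T.
  by move=> x_neq0; apply/rows_independent_det; rewrite det_tr det_mul_matrix_neq0.
have [HA hHA] := hermite_exists (k := 0) (reg a a_neq0).
have [b0|b_neq0] := boolP (b == 0).
  by exists HA; [exists HA => //; rewrite b0|apply: hermite_det_neq0 hHA].
have wb_neq0 : Zcomb w b != 0.
  by rewrite -(raddf0 (Zcomb w)) (inj_eq (Zbasis_inj hw)).
have [HB hHB] := hermite_exists (k := 0) (reg b wb_neq0).
have regM : rows_independent (row_mx HA HB).
  move=> u; rewrite mul_mx_row -[RHS]row_mx0 => /eq_row_mx [uHA0 _].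
  by apply: ((rows_independent_det HA).1 _ u uHA0); apply: hermite_det_neq0 hHA.
have [HM hHM] := hermite_exists regM.
exists HM; last exact: hermite_det_neq0 hHM.
by exists HA => //; rewrite (negPf b_neq0); exists HB.
Qed.

End Lattice.

(** * Annihilation of the factor ring by a multiple of the norm *)

(** Lagrange's theorem for a finite abelian group: translation by [x] permutes
    the group, so the sum of all elements equals itself plus [x] added as many
    times as there are elements. *)
Lemma mulrn_card_eq0 (V : zmodType) (x : V) :
  finite_set [set: V] -> x *+ #|` fset_set [set: V] | = 0.
Proof.
move=> finV; set F := fset_set _; have inF y : y \in F.
  by rewrite in_fset_set //; apply: mem_set.
have permF : perm_eq F [seq y + x | y <- F].
  apply: uniq_perm; rewrite ?fset_uniq //.
    by rewrite map_inj_uniq ?fset_uniq //; apply: addIr.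
  move=> y; rewrite inF; apply/esym/mapP; exists (y - x) => //.
  by rewrite subrK.
have /eqP := perm_big _ permF : \sum_(y <- F) y = _.
rewrite big_map big_split /= -subr_eq0 opprD addrA subrr add0r oppr_eq0.
by rewrite big_const_seq count_predT iter_addr_0 => /eqP.
Qed.

Lemma factor_ring_finite (R : comNzRingType) (J I : ideal R) :
  {subset J <= I} -> finite_set [set: factor_ring J] ->
  finite_set [set: factor_ring I].
Proof.
move=> sJI finJ.
pose lift x := projT1 (cid (@factor_proj_surj R J x)).
have liftK x : factor_proj J (lift x) = x by rewrite /lift; case: cid.
suff -> : [set: factor_ring I]%classic =
    ((fun x => factor_proj I (lift x)) @` setT)%classic.
  exact: finite_image.
apply/seteqP; split=> // y _; have [r <-] := factor_proj_surj y.
exists (factor_proj J r) => //; apply/eqP.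
rewrite -subr_eq0 -raddfB factor_proj_eq0 sJI //.
by rewrite -factor_proj_eq0 raddfB /= liftK subrr.
Qed.

Section Norm.
Variables (R : comNzRingType) (x : R) (h : nat) (I : ideal R).
Hypotheses (h_gt0 : (0 < h)%N) (norm_dvd : (elt_norm x %| h)%N) (xI : x \in I).

Lemma sub_principal_ideal : {subset ideal_gen [:: x] <= I}.
Proof.
move=> y /ideal_genP [c ->]; apply: rpred_sum => i _.
by rewrite (ord1 i) idealMl.
Qed.

(** The norm of an infinite quotient is 0 by convention, and 0 has no nonzero
    multiple. *)
Lemma finite_principal_factor : finite_set [set: factor_ring (ideal_gen [:: x])].
Proof.
have := dvdn_gt0 h_gt0 norm_dvd; rewrite /elt_norm /ideal_norm /fset_set.
by case: pselect => //= _; rewrite cardfs0.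
Qed.

Lemma finite_factor : finite_set [set: factor_ring I].
Proof. exact: factor_ring_finite sub_principal_ideal finite_principal_factor. Qed.

Lemma norm_kills (y : factor_ring I) : y *~ h = 0.
Proof.
have hI : h%:R \in I.
  have [e ->] := dvdnP norm_dvd; rewrite natrM idealMl //.
  apply: sub_principal_ideal; rewrite -factor_proj_eq0 rmorph_nat.
  by apply/eqP; apply: mulrn_card_eq0 finite_principal_factor.
have [r <-] := factor_proj_surj y.
rewrite -pmulrn -raddfMn; apply/eqP; rewrite factor_proj_eq0.
by rewrite -mulr_natr idealMl.
Qed.

End Norm.

(** * Cyclic decompositions from kernels *)

(** A group generated by the [v k] whose relations are exactly those implied
    by [d k * v k = 0] is their direct sum; the coefficients of an element are
    normalised by taking remainders. *)
Lemma cyclic_decomposition_kernel (V : zmodType) n (v : 'I_n -> V) (d : 'I_n -> int) :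
  (forall x, exists z, x = Zcomb v z) ->
  (forall z, Zcomb v z = 0 <-> forall k, (d k %| z 0%R k)%Z) ->
  (forall k, 0 < d k) ->
  cyclic_decomposition v d.
Proof.
move=> surj ker d_gt0.
have kerZ i e : v i *~ e = 0 <-> (d i %| e)%Z.
  rewrite -(Zcomb_delta v) -ZcombZ ker; split=> [/(_ i)|dvd k].
    by rewrite !mxE !eqxx mulr1.
  by rewrite !mxE eqxx; case: eqP => [->|_]; rewrite ?mulr1 ?mulr0 ?dvdz0.
split=> [i|x].
  split=> //; first exact/kerZ.
  move=> e /andP[e_gt0 lt_ed]; apply/eqP => /kerZ /dvdz_mod0P/eqP.
  by rewrite modz_small ?gt_eqF // ltW.
have [u ->] := surj x.
have ker2 y z : Zcomb v y = Zcomb v z <-> forall k, (y 0%R k == z 0%R k %[mod d k])%Z.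
  have -> : Zcomb v y = Zcomb v z <-> Zcomb v (y - z) = 0.
    by rewrite raddfB /=; split=> [->|/eqP]; rewrite ?subrr // subr_eq0 => /eqP.
  rewrite ker; split=> H k; have := H k; by rewrite eqz_mod_dvd !mxE.
exists (\row_k (u 0%R k %% d k)%Z); split=> [|z [z_lt /ker2 zE]].
  split=> [k|]; first by rewrite mxE modz_ge0 ?gt_eqF //= ltz_pmod.
  by apply/ker2 => k; rewrite mxE modz_mod.
apply/matrixP => i k; rewrite ord1 mxE; have /eqP -> := zE k.
by rewrite modz_small.
Qed.

Lemma Zcomb_widen (V : zmodType) n m (le_mn : (m <= n)%N) (v : 'I_n -> V) z :
  (forall k : 'I_n, (m <= k)%N -> v k = 0) ->
  Zcomb v z = \sum_(k < m) v (widen_ord le_mn k) *~ z 0 (widen_ord le_mn k).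
Proof.
move=> v0; rewrite -(@big_ord_narrow _ _ _ _ _ (fun k => v k *~ z 0 k) le_mn).
rewrite [LHS](bigID (fun k : 'I_n => (k < m)%N)).
rewrite /= [X in _ + X]big1 ?addr0 // => k.
by rewrite -leqNgt => /v0 ->; rewrite mul0rz.
Qed.

(** Generators of order 1 are zero and can be dropped. *)
Lemma cyclic_decomposition_truncate (V : zmodType) n m (le_mn : (m <= n)%N)
    (v : 'I_n -> V) (d : 'I_n -> int) :
  (forall x, exists z, x = Zcomb v z) ->
  (forall z, Zcomb v z = 0 <-> forall k, (d k %| z 0%R k)%Z) ->
  (forall k, 0 < d k) ->
  (forall k : 'I_n, (m <= k)%N -> d k = 1) ->
  cyclic_decomposition (fun k => v (widen_ord le_mn k))
    (fun k => d (widen_ord le_mn k)).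
Proof.
move=> surj ker d_gt0 d1.
have v0 (k : 'I_n) : (m <= k)%N -> v k = 0.
  move=> /d1 dk1; rewrite -(Zcomb_delta v); apply/ker => j.
  by rewrite mxE eqxx; case: eqP => [->|_]; rewrite ?dk1 ?dvd1z ?dvdz0.
have trunc z : Zcomb v z =
    Zcomb (fun k => v (widen_ord le_mn k)) (\row_k z 0 (widen_ord le_mn k)).
  by rewrite (Zcomb_widen le_mn) //; apply: eq_bigr => k _; rewrite mxE.
apply: cyclic_decomposition_kernel => //= [x|z].
  by have [z ->] := surj x; eexists; apply: trunc.
(* z' is z followed by zeros. *)
pose z' : 'rV[int]_n := \row_k oapp (z 0) 0 (insub (k : nat)).
have z'E k : z' 0 (widen_ord le_mn k) = z 0 k by rewrite mxE /= valK.
have -> : Zcomb (fun k => v (widen_ord le_mn k)) z = Zcomb v z'.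
  by rewrite trunc; congr Zcomb; apply/matrixP => i k; rewrite ord1 [RHS]mxE z'E.
rewrite ker; split=> [dvd k|dvd k]; first by rewrite -z'E.
have [lt_km|/d1 ->] := ltnP k m; last by rewrite dvd1z.
have -> : k = widen_ord le_mn (Ordinal lt_km) by apply: val_inj.
by rewrite z'E.
Qed.

(** * The diagonal of the Smith form *)

Section SmithDiagonal.
Variables (n : nat) (N V U S : 'M[int]_n) (hS : smith_normal_form N V U S).

Lemma smith_diag_gt0 i : 0 < S i i.
Proof. by have [_ _ _ _ [S_ge1 _]] := hS; rewrite gtz0_ge1. Qed.

Lemma det_smith_eq1 : \det S = 1 <-> forall i, S i i = 1.
Proof.
have [_ _ _ diagS _] := hS; rewrite det_trig ?is_diag_mx_is_trig //.
split=> [prod1 i|S1]; last by rewrite big1.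
have : (S i i %| 1%R)%Z by rewrite -prod1 (bigD1 i) //= dvdz_mulr.
by rewrite dvdz1 => /eqP; have := smith_diag_gt0 i; lia.
Qed.

Lemma smith_diag_eq1_mono (i j : 'I_n) : (i <= j)%N -> S i i = 1 -> S j j = 1.
Proof.
have [_ _ _ _ [_ dvdS]] := hS; move=> le_ij Si1.
have [k Ek] : exists k, (i + k = j)%N by exists (j - i)%N; rewrite subnKC.
elim: k j {le_ij} Ek => [|k IHk] j Ek.
  by rewrite -Si1; congr (S _ _); apply: val_inj; rewrite /= -Ek addn0.
have lt_ik : (i + k < n)%N by have := ltn_ord j; lia.
have := dvdS (Ordinal lt_ik) j; rewrite (IHk (Ordinal lt_ik)) // => /(_ _).
rewrite dvdz1 -Ek addnS => /(_ erefl)/eqP; have := smith_diag_gt0 j; lia.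
Qed.

(** Entries equal to 1 are followed only by 1, so the entries greater than 1
    form an initial segment. *)
Lemma smith_diag_cut :
  exists2 m, (m <= n)%N & forall i : 'I_n, (i < m)%N = (1 < S i i).
Proof.
have exm : exists m, (m == n) || [exists i : 'I_n, (i == m :> nat) && (S i i == 1)].
  by exists n; rewrite eqxx.
case: (ex_minnP exm) => m m_stop m_min; exists m; first by apply: m_min; rewrite eqxx.
move=> i; have S_gt0 := smith_diag_gt0 i; apply/idP/idP => [lt_im|S_gt1].
  suff : S i i != 1 by lia.
  apply: contraTneq lt_im => Si1; rewrite -leqNgt; apply: m_min.
  by apply/orP; right; apply/existsP; exists i; rewrite eqxx Si1.
rewrite ltnNge; apply: contraTN S_gt1 => le_mi.
case/orP: m_stop => [/eqP m_n|/existsP [j /andP[/eqP j_m /eqP Sj1]]].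
  by have := ltn_ord i; rewrite ltnNge -[X in (X <= i)%N]m_n le_mi.
by rewrite (@smith_diag_eq1_mono j) ?j_m // ltxx.
Qed.

End SmithDiagonal.

(** * The factor ring in Smith coordinates *)

Section Quotient.
Variables (O : comNzRingType) (n : nat) (w : 'I_n -> O) (hw : Zbasis w).
Variables (c : 'I_n -> 'I_n -> 'I_n -> int) (hc : multiplication_table w c).
Variables (I : ideal O) (HM V U S : 'M[int]_n).
Hypothesis I_span : forall u, Zcomb w u \in I <-> exists y, u^T = HM *m y.
Hypothesis hS : smith_normal_form HM V U S.

Lemma mem_smith u : Zcomb w u \in I <-> forall k, (S k k %| (V *m u^T) k 0%R)%Z.
Proof. by rewrite I_span; apply: smith_colspan hS _. Qed.

Lemma smith_whole_ring : \det S = 1 -> forall x, x \in I.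
Proof.
move=> /(det_smith_eq1 hS) S1 x; have [u ->] := Zbasis_surj hw x.
by apply/mem_smith => k; rewrite S1 dvd1z.
Qed.

Let q (i : 'I_n) : factor_ring I := factor_proj I (w i).
Let v (k : 'I_n) : factor_ring I := Zcomb q (row k (invmx V)^T).

Let uV : V^T \in unitmx.
Proof. by case: hS => uV _ _ _ _; rewrite unitmx_tr. Qed.

Let Zcomb_q u : Zcomb q u = factor_proj I (Zcomb w u).
Proof. by rewrite raddf_Zcomb. Qed.

Let Zcomb_v z : Zcomb v z = Zcomb q (z *m invmx V^T).
Proof. by rewrite -trmx_inv Zcomb_mulmx. Qed.

Let Zcomb_qv u : Zcomb q u = Zcomb v (u *m V^T).
Proof. by rewrite Zcomb_v mulmxK. Qed.

Let v_surj x : exists z, x = Zcomb v z.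
Proof.
have [r <-] := factor_proj_surj x; have [u ->] := Zbasis_surj hw r.
by exists (u *m V^T); rewrite -Zcomb_qv Zcomb_q.
Qed.

Let v_ker z : Zcomb v z = 0 <-> forall k, (S k k %| z 0%R k)%Z.
Proof.
rewrite Zcomb_v Zcomb_q.
have -> : factor_proj I (Zcomb w (z *m invmx V^T)) = 0 <->
    Zcomb w (z *m invmx V^T) \in I.
  by rewrite -factor_proj_eq0; split=> /eqP.
rewrite mem_smith -[V in V *m _]trmxK -trmx_mul mulmxKV //.
by split=> H k; have := H k; rewrite mxE.
Qed.

Let Zcomb_qM (x y : 'rV_n) :
  Zcomb q x * Zcomb q y = \sum_i \sum_j (q i * q j) *~ (x 0 i * y 0 j).
Proof.
rewrite mulr_suml; apply: eq_bigr => i _; rewrite mulr_sumr; apply: eq_bigr => j _.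
by rewrite mulrzAl mulrzAr -mulrzA (mulrC (y 0 j)).
Qed.

Let qM i j : q i * q j = Zcomb q (\row_k c i j k).
Proof.
rewrite /q -rmorphM /= hc raddf_sum; apply: eq_bigr => k _.
by rewrite mxE raddfMz.
Qed.

Section Table.
Variables (h : nat) (W : 'M[int]_n).
Hypotheses (h_kills : forall x : factor_ring I, x *~ h = 0) (hW : inverse_mod h V W).

(** As [h] annihilates the factor ring, the inverse of [V] modulo [h] gives the
    same generators as its inverse over the integers. *)
Let v_lift k : v k = Zcomb q (row k W^T).
Proof.
have uV' : V \in unitmx by rewrite -unitmx_tr.
pose E : 'M[int]_n := \matrix_(i, j) (((V *m W - 1%:M) i j) %/ h)%Z.
have VWE : V *m W - 1%:M = h%:Z *: E.
  apply/matrixP => i j; rewrite [RHS]mxE [E _ _]mxE mulrC divzK //.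
  have [/eqP VW _] := hW i j; rewrite eqz_mod_dvd in VW.
  by rewrite !mxE in VW *.
have -> : W = invmx V + h%:Z *: (invmx V *m E).
  by rewrite scalemxAr -VWE mulmxBr mulKmx // mulmx1 addrC subrK.
by rewrite !raddfD /= !linearZ /= ZcombZ h_kills addr0.
Qed.

(** The product of the lifts [row i W^T] and [row j W^T] has the coordinates
    [tilde_a]; multiplying by [V] expresses it in the generators [v k]. *)
Lemma smith_generator_mul i j : v i * v j = \sum_k v k *~ tilde_t c V W i j k.
Proof.
have -> : \sum_k v k *~ tilde_t c V W i j k =
    Zcomb v ((\row_r tilde_a c W r i j) *m V^T).
  apply: eq_bigr => k _; congr (_ *~ _).
  rewrite /tilde_t [LHS]mxE [RHS]mxE; apply: eq_bigr => r _.
  by rewrite [V^T _ _]mxE [(\row__ _) _ _]mxE [(\col__ _) _ _]mxE mulrC.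
rewrite -Zcomb_qv !v_lift Zcomb_qM.
under eq_bigr do under eq_bigr do rewrite qM -ZcombZ.
under eq_bigr do rewrite -raddf_sum.
rewrite -raddf_sum; congr Zcomb; apply/matrixP => i0 k; rewrite ord1 !mxE summxE.
under eq_bigr do rewrite summxE.
rewrite exchange_big; apply: eq_bigr => p _ /=.
rewrite !mxE mulr_suml; apply: eq_bigr => r _; rewrite !mxE; ring.
Qed.

Lemma smith_basis_representation m (le_mn : (m <= n)%N) :
  finite_set [set: factor_ring I] -> \det S != 1 ->
  (forall i : 'I_n, (i < m)%N = (1 < S i i)) ->
  let s := widen_ord le_mn in
  basis_representation (factor_ring I) (fun k : 'I_m => S (s k) (s k))
    (fun i j k : 'I_m => (tilde_t c V W (s i) (s j) (s k) %% S (s k) (s k))%Z).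
Proof.
move=> finI detS S_cut s.
have S_gt0 := smith_diag_gt0 hS.
have S1 (k : 'I_n) : (m <= k)%N -> S k k = 1.
  by move=> le_mk; have := S_cut k; have := S_gt0 k; lia.
have v_dec := cyclic_decomposition_truncate le_mn v_surj v_ker S_gt0 S1.
have v_S k : v k *~ S k k = 0.
  rewrite -(Zcomb_delta v) -ZcombZ; apply/v_ker => j; rewrite !mxE eqxx.
  by case: eqP => [->|_]; rewrite ?mulr1 ?mulr0 ?dvdz0.
have v0 (k : 'I_n) : (m <= k)%N -> v k = 0 by move=> /S1 Sk1; rewrite -(v_S k) Sk1.
split=> //.
- rewrite lt0n; apply: contraNneq detS => m0; apply/eqP/(det_smith_eq1 hS) => k.
  by rewrite S1 // m0.
- by move=> i; have := S_cut (s i); rewrite /= ltn_ord; lia.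
- by move=> i j k; rewrite modz_ge0 ?gt_eqF //= ltz_pmod.
exists (fun k => v (s k)); split=> // i j.
pose t : 'rV[int]_n := \row_k tilde_t c V W (s i) (s j) k.
have -> : v (s i) * v (s j) = Zcomb v t.
  by rewrite smith_generator_mul; apply: eq_bigr => k _; rewrite mxE.
rewrite (Zcomb_widen le_mn) //; apply: eq_bigr => k _; rewrite mxE.
rewrite [in LHS](divz_eq (tilde_t _ _ _ _ _ _) (S (s k) (s k))).
by rewrite mulrzDr mulrC mulrzA v_S mul0rz add0r.
Qed.

End Table.
End Quotient.

(** * Correctness of the algorithm *)

Theorem theorem4p2 (O : idomainType) (hO : dedekind O)
    (n : nat) (w : 'I_n -> O) (hw : Zbasis w)
    (c : 'I_n -> 'I_n -> 'I_n -> int) (hc : multiplication_table w c)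
    (a b : 'rV[int]_n) (alpha beta : O)
    (halpha : alpha = Zcomb w a) (alpha_neq0 : alpha != 0)
    (hbeta : beta = Zcomb w b)
    (h : nat) (hh : multiple_norm alpha beta h) :
  (exists out, main_algorithm c a b h out) /\
  (forall out, main_algorithm c a b h out ->
     correct_output (ideal_gen [:: alpha; beta]) out).
Proof.
have [h_gt0 norm_alpha _] := hh.
split.
  rewrite halpha in alpha_neq0.
  have [HM hHM detHM] := hermite_phase_exists hw hc b alpha_neq0.
  have [V [U [S hS]]] := smith_exists detHM.
  have [detS|detS] := eqVneq (\det S) 1.
    by exists WholeRing; apply: run_whole hHM hS detS.
  have [m le_mn S_cut] := smith_diag_cut hS.
  have hV : inverse_mod h V (invmx V).
    by case: hS => uV _ _ _ _ i j; rewrite mulmxV ?mulVmx.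
  by eexists; apply: (run_basis le_mn hHM hS detS hV S_cut).
move=> _ [HM V U S hHM hS detS|HM V U S W m le_mn hHM hS detS hW S_cut s] /=.
  rewrite halpha hbeta.
  exact: (smith_whole_ring hw (hermite_phase_ideal hw hc hHM) hS detS).
have alphaI : alpha \in ideal_gen [:: alpha; beta].
  by apply/mem_ideal_gen2; exists 1, 0; rewrite mul1r mul0r addr0.
have finI := finite_factor h_gt0 norm_alpha alphaI.
have kills := norm_kills h_gt0 norm_alpha alphaI.
move: finI kills; rewrite halpha hbeta => finI kills.
exact: (smith_basis_representation hw hc (hermite_phase_ideal hw hc hHM) hS kills hW).
Qed.
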